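(* Let $a\ge0$, $T>0$, $s\in[1,3)$, $z\in G^s([0,T])$, and let $$y(x,t)=\sum_{i\ge0}g_i(x)\,z^{(i)}(t),\qquad (x,t)\in[-1,0]\times[0,T],$$ where $(g_i)_{i\ge0}$ are the generating functions associated with $a$. Then $y\in G^{\frac s3,s}([-1,0]\times[0,T])$ and $y$ solves $$\begin{cases}\partial_t y+\partial_x^3 y+a\,\partial_x y=0, & x\in(-1,0),\ t\in(0,T),\\ y(0,t)=\partial_x y(0,t)=0, & t\in(0,T),\\ \partial_x^2y(0,t)=z(t), & t\in(0,T).\end{cases}$$
   Context: The generating functions $g_i:[-1,0]\to\mathbb R$, $i\ge0$, are defined inductively: $g_0$ is the solution of the Cauchy problem $g_0'''+a g_0'=0$ on $(-1,0)$, $g_0(0)=g_0'(0)=0$, $g_0''(0)=1$; and for $i\ge1$, $g_i$ is the solution of $g_i'''+a g_i'=-g_{i-1}$ on $(-1,0)$, $g_i(0)=g_i'(0)=g_i''(0)=0$. $\mathbb N=\{0,1,2,\dots\}$. For $s\ge 0$, $G^s([t_1,t_2])$ (functions Gevrey of order $s$) is the set of $u\in C^\infty([t_1,t_2])$ for which there are constants $C\ge 0$, $R>0$ with $|\partial_t^n u(t)|\le C\,(n!)^s/R^n$ for all $n\in\mathbb N$, $t\in[t_1,t_2]$. $G^{s_1,s_2}([x_1,x_2]\times[t_1,t_2])$ (functions Gevrey of order $s_1$ in $x$ and $s_2$ in $t$) is the set of $y\in C^\infty([x_1,x_2]\times[t_1,t_2])$ for which there are constants $C,R_1,R_2>0$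 with $|\partial_x^{n_1}\partial_t^{n_2}y(x,t)|\le C\,(n_1!)^{s_1}(n_2!)^{s_2}/(R_1^{n_1}R_2^{n_2})$ for all $n_1,n_2\in\mathbb N$ and all $(x,t)$ in the rectangle. *)

(* Defs.v *)
From Stdlib Require Import Reals Factorial.
From Coquelicot Require Import Coquelicot.
Open Scope R_scope.

(* [is_derive], with the neighbourhood filter of [x] restricted to [D]:
   one-sided at the endpoints when [D] is a closed interval. *)
Definition is_derive_on (D : R -> Prop) (f : R -> R) (x l : R) : Prop :=
  filterdiff f (within D (locally x)) (fun h : R => scal h l).

Definition ex_derive_on (D : R -> Prop) (f : R -> R) (x : R) : Prop :=
  exists l : R, is_derive_on D f x l.

(* Meaningful only where [ex_derive_on D f x] holds and [x] is not isolated
   in [D]; values of [f] outside [D] are then irrelevant. *)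
Definition Derive_on (D : R -> Prop) (f : R -> R) (x : R) : R :=
  iota (is_derive_on D f x).

Fixpoint Derive_n_on (D : R -> Prop) (f : R -> R) (n : nat) (x : R) : R :=
  match n with
  | O => f x
  | S n => Derive_on D (Derive_n_on D f n) x
  end.

Definition Icc (a b x : R) : Prop := a <= x <= b.

Definition Cinf_on (D : R -> Prop) (u : R -> R) : Prop :=
  forall (n : nat) (x : R), D x -> ex_derive_on D (Derive_n_on D u n) x.

Definition gevrey (s t1 t2 : R) (u : R -> R) : Prop :=
  Cinf_on (Icc t1 t2) u /\
  exists C r : R, 0 <= C /\ 0 < r /\
    forall (n : nat) (t : R), Icc t1 t2 t ->
      Rabs (Derive_n_on (Icc t1 t2) u n t)
        <= C * Rpower (INR (fact n)) s / r ^ n.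

Definition continuous_on_rect (Dx Dt : R -> Prop) (y : R -> R -> R) : Prop :=
  continuous_on (fun p : R * R => Dx (fst p) /\ Dt (snd p))
    (fun p : R * R => y (fst p) (snd p)).

Definition Derive_on_x (Dx : R -> Prop) (y : R -> R -> R) (x t : R) : R :=
  Derive_on Dx (fun x' => y x' t) x.

Definition Derive_on_t (Dt : R -> Prop) (y : R -> R -> R) (x t : R) : R :=
  Derive_on Dt (fun t' => y x t') t.

Fixpoint Ck_rect (Dx Dt : R -> Prop) (k : nat) (y : R -> R -> R) : Prop :=
  continuous_on_rect Dx Dt y /\
  match k with
  | O => True
  | S k =>
      (forall x t : R, Dx x -> Dt t ->
         ex_derive_on Dx (fun x' => y x' t) x /\
         ex_derive_on Dt (fun t' => y x t') t) /\
      Ck_rect Dx Dt k (Derive_on_x Dx y) /\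
      Ck_rect Dx Dt k (Derive_on_t Dt y)
  end.

Definition Cinf_rect (Dx Dt : R -> Prop) (y : R -> R -> R) : Prop :=
  forall k : nat, Ck_rect Dx Dt k y.

Definition partial_on (Dx Dt : R -> Prop) (n1 n2 : nat) (y : R -> R -> R)
    (x t : R) : R :=
  Derive_n_on Dx (fun x' => Derive_n_on Dt (y x') n2 t) n1 x.

Definition gevrey2 (s1 s2 x1 x2 t1 t2 : R) (y : R -> R -> R) : Prop :=
  Cinf_rect (Icc x1 x2) (Icc t1 t2) y /\
  exists C r1 r2 : R, 0 < C /\ 0 < r1 /\ 0 < r2 /\
    forall (n1 n2 : nat) (x t : R), Icc x1 x2 x -> Icc t1 t2 t ->
      Rabs (partial_on (Icc x1 x2) (Icc t1 t2) n1 n2 y x t)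
        <= C * (Rpower (INR (fact n1)) s1 * Rpower (INR (fact n2)) s2)
             / (r1 ^ n1 * r2 ^ n2).

(* Classical solution of u''' + a u' = f on (-1,0). Being C^2 up to the
   boundary is what ties the data at the endpoint 0 to the equation. *)
Definition cauchy_solution (a : R) (f : R -> R) (c : R) (u : R -> R) : Prop :=
  let I := Icc (-1) 0 in
  (forall x : R, I x ->
     ex_derive_on I u x /\ ex_derive_on I (Derive_n_on I u 1) x) /\
  continuous_on I (Derive_n_on I u 2) /\
  (forall x : R, -1 < x < 0 ->
     ex_derive_on I (Derive_n_on I u 2) x /\
     Derive_n_on I u 3 x + a * Derive_n_on I u 1 x = f x) /\
  u 0 = 0 /\ Derive_n_on I u 1 0 = 0 /\ Derive_n_on I u 2 0 = c.

Definition generating_functions (a : R) (g : nat -> R -> R) : Prop :=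
  cauchy_solution a (fun _ => 0) 1 (g O) /\
  forall i : nat, cauchy_solution a (fun x => - g i x) 0 (g (S i)).

(* Main.v *)
Require Import Defs.
From Stdlib Require Import Reals Factorial Lra Lia.
From Coquelicot Require Import Coquelicot.
Open Scope R_scope.

(* Each [g_i] solves [u'' + a u = h] with zero data at [0], and since [a >= 0]
   the propagators [cos] and [sin / w] ([w = sqrt a]) are no worse than for
   [a = 0]; hence [|g_i(x)| <= |x|^(3i+2) / (3i+2)!]. Feeding this in the
   recursion [g_i''' = - a g_i' - g_(i-1)] gives
   [|g_i^(n)| <= (1+a)^(i+n+1) / (3i+2-n)!] with truncated subtraction. Against
   [|z^(i+m)| <= C ((i+m)!)^s / r^(i+m)] with [s < 3], each term of
   [sum_i g_i^(n) z^(i+m)] is then at most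
   [C A1^n A2^m (n!)^(s/3) (m!)^s 2^(-i)]. This single estimate yields
   convergence, termwise differentiation to all orders (through the
   second-order Taylor remainder) and the Gevrey bounds. The equation follows
   by telescoping. *)

(** * One-sided derivatives on an interval *)

(** [filterdiff] asks for the estimate at every limit point of the filter. As [x] lies in [D], the
    only limit point of [within D (locally x)] is [x] itself, so a single estimate remains. *)
Lemma is_derive_on_eps (D : R -> Prop) (f : R -> R) (x l : R) :
  D x ->
  (is_derive_on D f x l <->
   forall eps : R, 0 < eps -> exists delta : R, 0 < delta /\
     forall y : R, D y -> Rabs (y - x) < delta ->
       Rabs (f y - f x - (y - x) * l) <= eps * Rabs (y - x)).
Proof.
intros Dx; split.
- intros [_ H] eps Heps.
  assert (Hlim : is_filter_lim (within D (locally x)) x).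
  { intros P HP. unfold within.
    apply (filter_imp P); auto. }
  destruct (H x Hlim (mkposreal eps Heps)) as [d Hd].
  exists d; split; [apply cond_pos | intros y Dy Hy; exact (Hd y Hy Dy)].
- intros H; split.
  + exact (is_linear_scal_l (V := R_NormedModule) l).
  + intros x' Hx' eps.
    (* Every ball around [x'] belongs to the filter restricted to [D], hence contains [x], which is
       in [D]. *)
    assert (Exx : x' = x).
    { apply eq_close; intros e.
      destruct (Hx' (ball x' e) (locally_ball x' e)) as [d Hd].
      apply Hd; [apply ball_center | exact Dx]. }
    subst x'.
    destruct (H eps (cond_pos eps)) as [d [Hd H']].
    exists (mkposreal d Hd); intros y Hy Dy; exact (H' y Dy Hy).
Qed.

Lemma is_derive_on_ext (D : R -> Prop) (f g : R -> R) (x l : R) :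
  D x -> (forall y : R, D y -> f y = g y) ->
  is_derive_on D f x l -> is_derive_on D g x l.
Proof.
intros Dx E. rewrite !is_derive_on_eps by exact Dx.
intros H eps Heps; destruct (H eps Heps) as [d [Hd H']].
exists d; split; [exact Hd | intros y Dy Hy; rewrite <- !E by assumption; auto].
Qed.

Lemma Icc_approach (a b x delta : R) :
  a < b -> Icc a b x -> 0 < delta ->
  exists y : R, Icc a b y /\ 0 < Rabs (y - x) < delta.
Proof.
unfold Icc; intros Hab Hx Hd.
(* A step of at most half the length, taken towards the farther endpoint, stays in the interval. *)
set (h := Rmin (delta / 2) ((b - a) / 2)).
assert (Hh : 0 < h) by (apply Rmin_glb_lt; lra).
assert (Hh1 : h <= delta / 2) by apply Rmin_l.
assert (Hh2 : h <= (b - a) / 2) by apply Rmin_r.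
destruct (Rle_dec x ((a + b) / 2)).
- exists (x + h). replace (x + h - x) with h by ring.
  rewrite Rabs_right; lra.
- exists (x - h). replace (x - h - x) with (- h) by ring.
  rewrite Rabs_Ropp, Rabs_right; lra.
Qed.

(** A nondegenerate interval has no isolated point. At a nearby [y], two distinct slopes, each with
    relative error [Rabs (l1 - l2) / 4], would differ by at most half of their own distance. *)
Lemma is_derive_on_Icc_unique (a b : R) (f : R -> R) (x l1 l2 : R) :
  a < b -> Icc a b x ->
  is_derive_on (Icc a b) f x l1 -> is_derive_on (Icc a b) f x l2 -> l1 = l2.
Proof.
intros Hab Hx; rewrite !is_derive_on_eps by exact Hx; intros H1 H2.
destruct (Req_dec l1 l2) as [E | N]; [exact E | exfalso].
assert (He : 0 < Rabs (l1 - l2) / 4).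
{ assert (0 < Rabs (l1 - l2)) by (apply Rabs_pos_lt; lra). lra. }
destruct (H1 _ He) as [d1 [Hd1 K1]]. destruct (H2 _ He) as [d2 [Hd2 K2]].
destruct (Icc_approach a b x (Rmin d1 d2) Hab Hx) as [y [Hy [Hp Hl]]].
{ now apply Rmin_glb_lt. }
assert (K1' := K1 y Hy (Rlt_le_trans _ _ _ Hl (Rmin_l _ _))).
assert (K2' := K2 y Hy (Rlt_le_trans _ _ _ Hl (Rmin_r _ _))).
assert (B : Rabs ((y - x) * (l1 - l2)) <= Rabs (l1 - l2) / 2 * Rabs (y - x)).
{ replace ((y - x) * (l1 - l2)) with
    ((f y - f x - (y - x) * l2) - (f y - f x - (y - x) * l1)) by ring.
  eapply Rle_trans; [apply Rabs_triang |]. rewrite Rabs_Ropp. lra. }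
rewrite Rabs_mult in B.
assert (0 < Rabs (l1 - l2)) by lra.
nra.
Qed.

Lemma Derive_on_eq (a b : R) (f : R -> R) (x l : R) :
  a < b -> Icc a b x ->
  is_derive_on (Icc a b) f x l -> Derive_on (Icc a b) f x = l.
Proof.
intros Hab Hx H; apply (iota_unique (V := R_CompleteNormedModule)); [| exact H].
intros l' H'; now apply (is_derive_on_Icc_unique a b f x).
Qed.

Lemma Derive_on_correct (a b : R) (f : R -> R) (x : R) :
  a < b -> Icc a b x -> ex_derive_on (Icc a b) f x ->
  is_derive_on (Icc a b) f x (Derive_on (Icc a b) f x).
Proof.
intros Hab Hx [l H]; now rewrite (Derive_on_eq a b f x l).
Qed.

Lemma is_derive_on_plus (D : R -> Prop) (f g : R -> R) (x l m : R) :
  is_derive_on D f x l -> is_derive_on D g x m ->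
  is_derive_on D (fun x' => f x' + g x') x (l + m).
Proof.
intros Hf Hg.
eapply filterdiff_ext_lin.
- exact (filterdiff_plus_fct _ _ _ _ Hf Hg).
- intros h; symmetry; exact (scal_distr_l h l m).
Qed.

Lemma is_derive_on_scal (D : R -> Prop) (k : R) (f : R -> R) (x l : R) :
  is_derive_on D f x l -> is_derive_on D (fun x' => k * f x') x (k * l).
Proof.
intros Hf.
eapply filterdiff_ext_lin.
- exact (filterdiff_scal_r_fct k _ _ Rmult_comm Hf).
- intros h; unfold scal; simpl; unfold mult; simpl; ring.
Qed.

Lemma is_derive_on_const (D : R -> Prop) (c x : R) :
  is_derive_on D (fun _ => c) x 0.
Proof.
eapply filterdiff_ext_lin.
- exact (filterdiff_const c).
- intros h; symmetry; exact (scal_zero_r h).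
Qed.

Lemma is_derive_on_continuous (D : R -> Prop) (f df : R -> R) :
  (forall x : R, D x -> is_derive_on D f x (df x)) -> continuous_on D f.
Proof.
intros H x Dx. specialize (H x Dx). rewrite is_derive_on_eps in H by exact Dx.
destruct (H 1 Rlt_0_1) as [d [Hd K]].
apply filterlim_locally; intros eps.
set (e := eps / (1 + Rabs (df x))).
assert (Hn : 0 <= Rabs (df x)) by apply Rabs_pos.
assert (He : 0 < e) by (apply Rdiv_lt_0_compat; [apply cond_pos | lra]).
assert (Hm : 0 < Rmin d e) by now apply Rmin_glb_lt.
exists (mkposreal _ Hm); intros y Hy Dy.
change (Rabs (y - x) < Rmin d e) in Hy.
change (Rabs (f y - f x) < eps).
assert (Hy1 := Rlt_le_trans _ _ _ Hy (Rmin_l _ _)).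
assert (Hy2 := Rlt_le_trans _ _ _ Hy (Rmin_r _ _)).
specialize (K y Dy Hy1).
replace (f y - f x) with ((f y - f x - (y - x) * df x) + (y - x) * df x) by ring.
eapply Rle_lt_trans; [apply Rabs_triang |].
rewrite Rabs_mult.
apply Rle_lt_trans with (Rabs (y - x) * (1 + Rabs (df x))); [nra |].
replace (pos eps) with (e * (1 + Rabs (df x))) by (unfold e; field; lra).
apply Rmult_lt_compat_r; lra.
Qed.

(** Passage to two-sided derivatives, the form in which the mean value theorem and [auto_derive]
    work. *)
Lemma is_derive_on_interior (a b : R) (f : R -> R) (x l : R) :
  a < x < b -> is_derive_on (Icc a b) f x l -> is_derive f x l.
Proof.
intros Hx H. rewrite is_derive_on_eps in H by (unfold Icc; lra).
split; [exact (is_linear_scal_l (V := R_NormedModule) l) |].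
intros x' Hx' eps.
apply (is_filter_lim_locally_unique (V := R_NormedModule)) in Hx'; subst x'.
destruct (H eps (cond_pos eps)) as [d [Hd K]].
assert (Hm : 0 < Rmin d (Rmin (x - a) (b - x))) by (repeat apply Rmin_glb_lt; lra).
exists (mkposreal _ Hm); intros y Hy.
change (Rabs (y - x) < Rmin d (Rmin (x - a) (b - x))) in Hy.
apply Rmin_Rgt_l in Hy; destruct Hy as [Hy1 Hy].
apply Rmin_Rgt_l in Hy; destruct Hy as [Hy2 Hy3].
apply Rabs_def2 in Hy2; apply Rabs_def2 in Hy3.
apply (K y); [unfold Icc; lra | lra].
Qed.

Lemma is_derive_on_of_is_derive (D : R -> Prop) (f : R -> R) (x l : R) :
  D x -> is_derive f x l -> is_derive_on D f x l.
Proof.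
intros Dx [_ H]. rewrite is_derive_on_eps by exact Dx.
intros eps Heps.
destruct (H x (fun P HP => HP) (mkposreal eps Heps)) as [d Hd].
exists d; split; [apply cond_pos | intros y _ Hy; exact (Hd y Hy)].
Qed.

(* Composing with the clamp onto [a,b] removes the one-sidedness at the
   endpoints. *)
Lemma MVT_Icc (a b : R) (f df : R -> R) :
  a < b -> continuous_on (Icc a b) f ->
  (forall x : R, a < x < b -> is_derive f x (df x)) ->
  forall x y : R, Icc a b x -> Icc a b y -> exists c : R,
    Rmin x y <= c <= Rmax x y /\ f y - f x = df c * (y - x).
Proof.
intros Hab Hc Hd x y Hx Hy.
set (cl := fun u => Rmax a (Rmin b u)).
assert (Hcl : forall u, Icc a b (cl u)).
{ intros u; unfold Icc, cl; split; [apply Rmax_l |].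
  apply Rmax_lub; [lra | apply Rmin_l]. }
assert (Hid : forall u, Icc a b u -> cl u = u).
{ unfold Icc, cl; intros u Hu. rewrite Rmin_right, Rmax_right; lra. }
assert (Hlip : forall u v, Rabs (cl u - cl v) <= Rabs (u - v)).
{ intros u v; unfold cl, Rmax, Rmin.
  repeat destruct Rle_dec; unfold Rabs; repeat destruct Rcase_abs; lra. }
assert (Hmin : a <= Rmin x y /\ Rmax x y <= b).
{ unfold Icc in *; split; [apply Rmin_glb | apply Rmax_lub]; lra. }
destruct (MVT_gen (fun u => f (cl u)) x y df) as [c [Hc1 Hc2]].
- intros u Hu.
  apply (is_derive_ext_loc f).
  + assert (Hp : 0 < Rmin (u - a) (b - u)) by (apply Rmin_glb_lt; lra).
    exists (mkposreal _ Hp); intros v Hv.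
    change (Rabs (v - u) < Rmin (u - a) (b - u)) in Hv.
    apply Rmin_Rgt_l in Hv; destruct Hv as [H1 H2].
    apply Rabs_def2 in H1; apply Rabs_def2 in H2.
    rewrite Hid; [reflexivity | unfold Icc; lra].
  + apply Hd; lra.
- intros u _. apply continuity_pt_filterlim.
  apply filterlim_locally; intros eps.
  destruct (proj1 (filterlim_locally _ _) (Hc (cl u) (Hcl u)) eps) as [d Hd'].
  exists d; intros v Hv. apply Hd'; [| apply Hcl].
  exact (Rle_lt_trans _ _ _ (Hlip v u) Hv).
- rewrite !Hid in Hc2 by assumption. exists c; split; assumption.
Qed.

Lemma Rabs_between (x y c : R) :
  Rmin x y <= c <= Rmax x y -> Rabs (c - x) <= Rabs (y - x).
Proof.
unfold Rmin, Rmax; destruct Rle_dec; intros H;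
  unfold Rabs; repeat destruct Rcase_abs; lra.
Qed.

Lemma Icc_between (a b x y c : R) :
  Icc a b x -> Icc a b y -> Rmin x y <= c <= Rmax x y -> Icc a b c.
Proof.
unfold Icc, Rmin, Rmax; destruct Rle_dec; lra.
Qed.

(** Difference quotients at an endpoint are values of [df] at intermediate points, and these
    converge by continuity. This is how a differential equation known only in the open interval
    reaches the endpoints. *)
Lemma is_derive_on_closure (a b : R) (f df : R -> R) :
  a < b -> continuous_on (Icc a b) f -> continuous_on (Icc a b) df ->
  (forall x : R, a < x < b -> is_derive f x (df x)) ->
  forall x : R, Icc a b x -> is_derive_on (Icc a b) f x (df x).
Proof.
intros Hab Hf Hdf Hd x Hx. rewrite is_derive_on_eps by exact Hx.
intros eps Heps.
destruct (proj1 (filterlim_locally _ _) (Hdf x Hx) (mkposreal eps Heps)) as [d K].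
exists d; split; [apply cond_pos | intros y Hy Hyx].
destruct (MVT_Icc a b f df Hab Hf Hd x y Hx Hy) as [c [Hc E]].
assert (Hcx : Rabs (df c - df x) < eps).
{ apply (K c); [| now apply (Icc_between a b x y)].
  exact (Rle_lt_trans _ _ _ (Rabs_between x y c Hc) Hyx). }
rewrite E. replace (df c * (y - x) - (y - x) * df x)
  with ((df c - df x) * (y - x)) by ring.
rewrite Rabs_mult. apply Rmult_le_compat_r; [apply Rabs_pos | lra].
Qed.

Lemma Lipschitz_Icc (a b : R) (f df : R -> R) (K : R) :
  a < b ->
  (forall x : R, Icc a b x -> is_derive_on (Icc a b) f x (df x)) ->
  (forall x : R, Icc a b x -> Rabs (df x) <= K) ->
  forall x y : R, Icc a b x -> Icc a b y ->
    Rabs (f y - f x) <= K * Rabs (y - x).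
Proof.
intros Hab Hf HK x y Hx Hy.
destruct (MVT_Icc a b f df Hab (is_derive_on_continuous _ _ _ Hf)) with x y
  as [c [Hc E]]; auto.
{ intros u Hu. apply (is_derive_on_interior a b); [exact Hu |].
  apply Hf; unfold Icc; lra. }
rewrite E, Rabs_mult. apply Rmult_le_compat_r; [apply Rabs_pos |].
apply HK; now apply (Icc_between a b x y).
Qed.

(** Two uses of the mean value theorem, first for [f] and then for [df] between [x] and the
    intermediate point; this gives the constant [K] instead of the sharp [K / 2]. *)
Lemma Taylor1_Icc (a b : R) (f df ddf : R -> R) (K : R) :
  a < b ->
  (forall x : R, Icc a b x -> is_derive_on (Icc a b) f x (df x)) ->
  (forall x : R, Icc a b x -> is_derive_on (Icc a b) df x (ddf x)) ->
  (forall x : R, Icc a b x -> Rabs (ddf x) <= K) ->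
  forall x y : R, Icc a b x -> Icc a b y ->
    Rabs (f y - f x - (y - x) * df x) <= K * Rabs (y - x) * Rabs (y - x).
Proof.
intros Hab Hf Hdf HK x y Hx Hy.
destruct (MVT_Icc a b f df Hab (is_derive_on_continuous _ _ _ Hf)) with x y
  as [c [Hc E]]; auto.
{ intros u Hu. apply (is_derive_on_interior a b); [exact Hu |].
  apply Hf; unfold Icc; lra. }
assert (Hcx := Lipschitz_Icc a b df ddf K Hab Hdf HK x c Hx
                 (Icc_between a b x y c Hx Hy Hc)).
assert (Hb := Rabs_between x y c Hc).
assert (0 <= K) by (apply Rle_trans with (Rabs (ddf x)); [apply Rabs_pos | auto]).
rewrite E. replace (df c * (y - x) - (y - x) * df x)
  with ((df c - df x) * (y - x)) by ring.
rewrite Rabs_mult. apply Rmult_le_compat_r; [apply Rabs_pos |].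
nra.
Qed.

Lemma continuous_on_plus_mult (D : R -> Prop) (f g : R -> R) :
  continuous_on D f -> continuous_on D g ->
  continuous_on D (fun x => f x + g x) /\ continuous_on D (fun x => f x * g x).
Proof.
intros Hf Hg; split; intros x Dx.
- exact (filterlim_comp_2 _ _ _ (Hf x Dx) (Hg x Dx) (filterlim_plus (V := R_NormedModule) _ _)).
- exact (filterlim_comp_2 _ _ _ (Hf x Dx) (Hg x Dx) (filterlim_mult (K := R_AbsRing) _ _)).
Qed.

(** * Dominated series and termwise differentiation *)

Lemma ex_series_dominated (f : nat -> R) (K : R) :
  (forall i : nat, Rabs (f i) <= K * (/ 2) ^ i) ->
  ex_series f /\ Rabs (Series f) <= 2 * K.
Proof.
intros H.
assert (Hq : Rabs (/ 2) < 1) by (rewrite Rabs_right; lra).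
assert (Hg : ex_series (fun i => K * (/ 2) ^ i)).
{ apply (ex_series_scal_l (V := R_NormedModule) K), ex_series_geom, Hq. }
assert (Ha : ex_series (fun i => Rabs (f i))).
{ apply (ex_series_le (V := R_CompleteNormedModule) _ (fun i => K * (/ 2) ^ i));
    [| exact Hg].
  intros i. change (Rabs (Rabs (f i)) <= K * (/ 2) ^ i).
  now rewrite Rabs_Rabsolu. }
split; [now apply ex_series_Rabs |].
eapply Rle_trans; [now apply Series_Rabs |].
replace (2 * K) with (Series (fun i => K * (/ 2) ^ i)).
- apply Series_le; [| exact Hg]. intros i; split; [apply Rabs_pos | apply H].
- rewrite Series_scal_l, Series_geom by exact Hq. field.
Qed.

(** The summable bound on second derivatives controls the Taylor remainders of all terms at once:
    their sum is at most [2 * K2 * Rabs (y - x) ^ 2]. *)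
Lemma is_derive_on_Series (a b : R) (f df ddf : nat -> R -> R) (K0 K1 K2 : R) :
  a < b ->
  (forall i x, Icc a b x -> is_derive_on (Icc a b) (f i) x (df i x)) ->
  (forall i x, Icc a b x -> is_derive_on (Icc a b) (df i) x (ddf i x)) ->
  (forall i x, Icc a b x -> Rabs (f i x) <= K0 * (/ 2) ^ i) ->
  (forall i x, Icc a b x -> Rabs (df i x) <= K1 * (/ 2) ^ i) ->
  (forall i x, Icc a b x -> Rabs (ddf i x) <= K2 * (/ 2) ^ i) ->
  forall x : R, Icc a b x ->
    is_derive_on (Icc a b) (fun x' => Series (fun i => f i x')) x
      (Series (fun i => df i x)).
Proof.
intros Hab Hf Hdf B0 B1 B2 x Hx. rewrite is_derive_on_eps by exact Hx.
assert (HK : 0 <= K2).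
{ specialize (B2 O x Hx). rewrite pow_O, Rmult_1_r in B2.
  eapply Rle_trans; [apply Rabs_pos | exact B2]. }
intros eps Heps.
(* Chosen so that [2 * K2 * Rabs (y - x) <= eps]; the [+ 1] covers [K2 = 0]. *)
exists (eps / (2 * K2 + 1)); split; [apply Rdiv_lt_0_compat; lra |].
intros y Hy Hyx.
assert (S0 : forall u, Icc a b u -> ex_series (fun i => f i u)).
{ intros u Hu; eapply ex_series_dominated; intros i; now apply B0. }
assert (S1 : ex_series (fun i => df i x)).
{ eapply ex_series_dominated; intros i; now apply B1. }
rewrite <- Series_minus by auto.
rewrite <- Series_scal_l.
rewrite <- Series_minus.
2: now apply (ex_series_minus (V := R_NormedModule)); auto.
2: now apply (ex_series_scal_l (V := R_NormedModule)).
destruct (ex_series_dominated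
  (fun i => f i y - f i x - (y - x) * df i x)
  (K2 * Rabs (y - x) * Rabs (y - x))) as [_ H].
{ intros i.
  eapply Rle_trans.
  - apply (Taylor1_Icc a b (f i) (df i) (ddf i) (K2 * (/ 2) ^ i)); auto.
  - right; ring. }
eapply Rle_trans; [exact H |].
rewrite <- !Rmult_assoc. apply Rmult_le_compat_r; [apply Rabs_pos |].
apply Rmult_lt_compat_r with (r := 2 * K2 + 1) in Hyx; [| lra].
replace (eps / (2 * K2 + 1) * (2 * K2 + 1)) with eps in Hyx by (field; lra).
assert (0 <= Rabs (y - x)) by apply Rabs_pos. nra.
Qed.

(** * The generating functions *)

Lemma is_derive_power_fact (H : R) (k : nat) (x : R) :
  is_derive (fun t => H * (- t) ^ S k / INR (fact (S k))) x
    (- (H * (- x) ^ k / INR (fact k))).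
Proof.
assert (0 < INR (fact k)) by apply INR_fact_lt_0.
assert (0 < INR (S k)) by (apply lt_0_INR; lia).
rewrite fact_simpl, mult_INR.
evar_last; [auto_derive; trivial |].
change (Init.Nat.pred (S k)) with k.
change (match k with O => 1 | S _ => INR k + 1 end) with (INR (S k)).
field; lra.
Qed.

(** With [P] the right-hand side, [f - P] has nonnegative derivative and vanishes at [0], so it is
    nonpositive to the left of [0]. *)
Lemma power_fact_comparison (f df : R -> R) (H : R) (k : nat) :
  continuous_on (Icc (-1) 0) f ->
  (forall x, -1 < x < 0 -> is_derive f x (df x)) ->
  (forall x, Icc (-1) 0 x -> - (H * (- x) ^ k / INR (fact k)) <= df x) ->
  f 0 = 0 ->
  forall x, Icc (-1) 0 x -> f x <= H * (- x) ^ S k / INR (fact (S k)).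
Proof.
intros Hc Hd Hb H0 x Hx.
set (P := fun t => H * (- t) ^ S k / INR (fact (S k))).
set (dP := fun t => - (- (H * (- t) ^ k / INR (fact k)))).
assert (HP : forall t, is_derive (fun t => - P t) t (dP t)).
{ intros t; apply (is_derive_opp (V := R_NormedModule)), is_derive_power_fact. }
destruct (MVT_Icc (-1) 0 (fun t => f t + - P t) (fun t => df t + dP t))
  with x 0 as [c [Hcx E]].
- lra.
- apply continuous_on_plus_mult; [exact Hc |].
  apply (is_derive_on_continuous _ _ dP).
  intros t Ht; now apply is_derive_on_of_is_derive.
- intros t Ht. apply (is_derive_plus (V := R_NormedModule)); [now apply Hd | apply HP].
- exact Hx.
- unfold Icc; lra.
- assert (Hci : Icc (-1) 0 c).
  { apply (Icc_between _ _ x 0); [exact Hx | unfold Icc; lra | exact Hcx]. }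
  specialize (Hb c Hci).
  assert (P 0 = 0).
  { unfold P. rewrite Ropp_0, pow_ne_zero by lia. unfold Rdiv; ring. }
  assert (0 <= df c + dP c) by (unfold dP; lra).
  unfold Icc in Hx. change (f x <= P x). nra.
Qed.

(** The comparison is applied to [f] and to [- f]. Each use stands for one integration from [0] and
    raises the exponent by one. *)
Lemma power_fact_integral_bound (f df : R -> R) (H : R) (k : nat) :
  continuous_on (Icc (-1) 0) f ->
  (forall x, -1 < x < 0 -> is_derive f x (df x)) ->
  (forall x, Icc (-1) 0 x -> Rabs (df x) <= H * (- x) ^ k / INR (fact k)) ->
  f 0 = 0 ->
  forall x, Icc (-1) 0 x -> Rabs (f x) <= H * (- x) ^ S k / INR (fact (S k)).
Proof.
intros Hc Hd Hb H0 x Hx.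
apply Rabs_le; split.
- apply Ropp_le_cancel; rewrite Ropp_involutive.
  apply (power_fact_comparison (fun t => - f t) (fun t => - df t)).
  + intros t Ht. exact (filterlim_comp _ _ _ _ _ _ _ _ (Hc t Ht)
      (filterlim_opp (V := R_NormedModule) _)).
  + intros t Ht. now apply (is_derive_opp (V := R_NormedModule)), Hd.
  + intros t Ht. apply Ropp_le_contravar.
    eapply Rle_trans; [apply Rle_abs | now apply Hb].
  + lra.
  + exact Hx.
- apply (power_fact_comparison f df); auto.
  intros t Ht. specialize (Hb t Ht). apply Rabs_le_between in Hb. lra.
Qed.

(* With [w = sqrt a], the function
   [W t = u' t * cos (w (x - t)) - w * u t * sin (w (x - t))] satisfies
   [W' t = h t * cos (w (x - t))], [W 0 = 0] and [W x = u' x]. *)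
Lemma oscillator_bound (a : R) (u du ddu : R -> R) (H : R) (k : nat) :
  0 <= a ->
  (forall x, Icc (-1) 0 x -> is_derive_on (Icc (-1) 0) u x (du x)) ->
  (forall x, Icc (-1) 0 x -> is_derive_on (Icc (-1) 0) du x (ddu x)) ->
  (forall x, Icc (-1) 0 x ->
     Rabs (ddu x + a * u x) <= H * (- x) ^ k / INR (fact k)) ->
  u 0 = 0 -> du 0 = 0 ->
  forall x, Icc (-1) 0 x ->
    Rabs (du x) <= H * (- x) ^ S k / INR (fact (S k)) /\
    Rabs (u x) <= H * (- x) ^ S (S k) / INR (fact (S (S k))).
Proof.
intros Ha Hu Hdu Hb u0 du0.
assert (Hint : forall x, -1 < x < 0 -> is_derive u x (du x) /\ is_derive du x (ddu x)).
{ intros x Hx. assert (Icc (-1) 0 x) by (unfold Icc; lra).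
  split; apply (is_derive_on_interior (-1) 0); auto. }
assert (B : forall x, Icc (-1) 0 x ->
  Rabs (du x) <= H * (- x) ^ S k / INR (fact (S k))).
{ intros x Hx. set (w := sqrt a).
  assert (Hw : w * w = a) by now apply sqrt_sqrt.
  set (W := fun t => du t * cos (w * (x - t)) + u t * (- w * sin (w * (x - t)))).
  replace (du x) with (W x).
  2: { unfold W. rewrite Rminus_diag, Rmult_0_r, cos_0, sin_0. ring. }
  assert (Htrig : continuous_on (Icc (-1) 0) (fun t => cos (w * (x - t))) /\
          continuous_on (Icc (-1) 0) (fun t => - w * sin (w * (x - t)))).
  { split; apply continuous_on_forall; intros t _;
      apply (ex_derive_continuous (V := R_NormedModule)); auto_derive; trivial. }
  apply (power_fact_integral_bound W
    (fun t => (ddu t + a * u t) * cos (w * (x - t)))).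
  - apply continuous_on_plus_mult; apply continuous_on_plus_mult;
      try apply Htrig; eapply is_derive_on_continuous; eassumption.
  - intros t Ht. destruct (Hint t Ht) as [D1 D2]. unfold W.
    evar_last.
    + auto_derive; [| reflexivity].
      repeat split; eexists; eassumption.
    + change (Derive (fun t => u t) t) with (Derive u t).
      change (Derive (fun t => du t) t) with (Derive du t).
      rewrite (is_derive_unique _ _ _ D1), (is_derive_unique _ _ _ D2), <- Hw.
      unfold Rminus; ring.
  - intros t Ht. rewrite Rabs_mult.
    apply Rle_trans with (2 := Hb t Ht).
    rewrite <- (Rmult_1_r (Rabs (ddu t + a * u t))) at 2.
    apply Rmult_le_compat_l; [apply Rabs_pos |].
    apply Rabs_le, COS_bound.
  - unfold W. rewrite u0, du0. ring.
  - exact Hx. }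
(* The bound on [u] is one more integration from [0], of the bound just obtained for [du]. *)
intros x Hx; split; [now apply B |].
apply (power_fact_integral_bound u du); auto.
- now apply (is_derive_on_continuous _ _ du).
- intros t Ht; now apply Hint.
Qed.

(** The definition gives the third derivative only in the open interval. Continuity of [f - a u']
    and of [u''] up to the boundary extends it to the endpoints. *)
Lemma cauchy_solution_regular (a : R) (f : R -> R) (c : R) (u : R -> R) :
  let I := Icc (-1) 0 in
  continuous_on I f -> cauchy_solution a f c u ->
  forall x, I x ->
    is_derive_on I u x (Derive_n_on I u 1 x) /\
    is_derive_on I (Derive_n_on I u 1) x (Derive_n_on I u 2 x) /\
    is_derive_on I (Derive_n_on I u 2) x (f x - a * Derive_n_on I u 1 x).
Proof.
intros I Hf (H12 & Hc & H3 & _).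
assert (D2 : forall x, I x ->
  is_derive_on I (Derive_n_on I u 1) x (Derive_n_on I u 2 x)).
{ intros x Hx. apply Derive_on_correct; [lra | exact Hx | now apply H12]. }
intros x Hx; split; [| split; [now apply D2 |]].
- apply Derive_on_correct; [lra | exact Hx | now apply H12].
- apply (is_derive_on_closure (-1) 0 _ (fun x => f x - a * Derive_n_on I u 1 x)).
  + lra.
  + exact Hc.
  + apply (continuous_on_ext I (fun x => f x + (- a) * Derive_n_on I u 1 x)).
    { intros t _. unfold Rminus. now rewrite Ropp_mult_distr_l. }
    apply continuous_on_plus_mult; [exact Hf |].
    apply continuous_on_plus_mult.
    * apply (is_derive_on_continuous _ _ (fun _ => 0)).
      intros t _; apply is_derive_on_const.
    * exact (is_derive_on_continuous _ _ _ D2).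
  + intros t Ht. destruct (H3 t Ht) as [H4 H5].
    assert (It : I t) by (unfold I, Icc; lra).
    apply (is_derive_on_interior (-1) 0); [exact Ht |].
    change (Derive_n_on I u 3 t + a * Derive_n_on I u 1 t = f t) in H5.
    replace (f t - a * Derive_n_on I u 1 t) with (Derive_n_on I u 3 t)
      by (rewrite <- H5; ring).
    apply Derive_on_correct; [lra | exact It | exact H4].
  + exact Hx.
Qed.

(** The bounded quantity [u'' + a u] is the equation integrated once: an oscillator with zero data
    at [0]. The estimate of [u] keeps its power of [- x], since it will be integrated again as the
    source of the next function; for the derivatives the power is bounded by [1]. *)
Lemma cauchy_solution_bound (a : R) (f : R -> R) (c : R) (u : R -> R) (k : nat) :
  let I := Icc (-1) 0 in
  0 <= a -> continuous_on I f -> cauchy_solution a f c u ->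
  (forall x, I x ->
     Rabs (Derive_n_on I u 2 x + a * u x) <= (- x) ^ k / INR (fact k)) ->
  forall x, I x ->
    Rabs (u x) <= (- x) ^ S (S k) / INR (fact (S (S k))) /\
    Rabs (Derive_n_on I u 1 x) <= / INR (fact (S k)) /\
    Rabs (Derive_n_on I u 2 x) <= (1 + a) / INR (fact k).
Proof.
intros I Ha Hf Hu Hh x Hx.
assert (Reg := cauchy_solution_regular a f c u Hf Hu).
destruct Hu as (_ & _ & _ & u0 & du0 & _).
destruct (oscillator_bound a u (Derive_n_on I u 1) (Derive_n_on I u 2) 1 k)
  with x as [B1 B0]; auto.
- intros t Ht; now apply Reg.
- intros t Ht; now apply Reg.
- intros t Ht. rewrite Rmult_1_l; now apply Hh.
- rewrite Rmult_1_l in B0, B1.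
  assert (Pow : forall n, 0 <= (- x) ^ n <= 1).
  { intros n. unfold I, Icc in Hx. split; [apply pow_le; lra |].
    rewrite <- (pow1 n). apply pow_incr; lra. }
  assert (Frac : forall n, (- x) ^ n / INR (fact n) <= / INR (fact n)).
  { intros n. rewrite <- (Rmult_1_l (/ _)). apply Rmult_le_compat_r; [| apply Pow].
    left; apply Rinv_0_lt_compat, INR_fact_lt_0. }
  split; [exact B0 | split].
  + eapply Rle_trans; [exact B1 | apply Frac].
  (* [u''] is recovered as [(u'' + a u) - a u]; weakening the bound of [u] to [1 / k!] gives both
     parts the same denominator. *)
  + assert (Rabs (u x) <= / INR (fact k)).
    { eapply Rle_trans; [exact B0 |]. eapply Rle_trans; [apply Frac |].
      apply Rinv_le_contravar; [apply INR_fact_lt_0 |].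
      apply le_INR, fact_le; lia. }
    assert (Hk := Rle_trans _ _ _ (Hh x Hx) (Frac k)).
    replace (Derive_n_on I u 2 x)
      with ((Derive_n_on I u 2 x + a * u x) + - (a * u x)) by ring.
    eapply Rle_trans; [apply Rabs_triang |].
    rewrite Rabs_Ropp, Rabs_mult, (Rabs_right a) by lra.
    unfold Rdiv; rewrite Rmult_plus_distr_r. nra.
Qed.

Lemma generating_functions_continuous (a : R) (g : nat -> R -> R) (i : nat) :
  generating_functions a g -> continuous_on (Icc (-1) 0) (g i).
Proof.
intros [H0 HS].
assert (H : exists f c, cauchy_solution a f c (g i)).
{ destruct i; eauto. }
destruct H as (f & c & H & _).
apply (is_derive_on_continuous _ _ (Derive_n_on (Icc (-1) 0) (g i) 1)).
intros x Hx. apply Derive_on_correct; [lra | exact Hx | now apply H].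
Qed.

(** Reading the missing predecessor of [g 0] as zero puts all the Cauchy problems in one form. *)
Lemma generating_functions_source (a : R) (g : nat -> R -> R) (i : nat) :
  generating_functions a g ->
  continuous_on (Icc (-1) 0)
    (fun x => match i with O => 0 | S j => - g j x end) /\
  cauchy_solution a (fun x => match i with O => 0 | S j => - g j x end)
    (match i with O => 1 | S _ => 0 end) (g i).
Proof.
intros Hg. destruct i as [| i]; (split; [| first [exact (proj2 Hg i) | exact (proj1 Hg)]]).
- apply (is_derive_on_continuous _ _ (fun _ => 0)).
  intros t _; apply is_derive_on_const.
- intros x Hx. exact (filterlim_comp _ _ _ _ _ _ _ _
    (generating_functions_continuous a g i Hg x Hx)
    (filterlim_opp (V := R_NormedModule) _)).
Qed.

(** Going from [g i] to [g (S i)] costs three integrations: one from [- g i] to [u'' + a u], then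
    two in the oscillator estimate. Hence the exponent grows by three. *)
Lemma generating_functions_low_bounds (a : R) (g : nat -> R -> R) :
  0 <= a -> generating_functions a g ->
  forall (i : nat) (x : R), Icc (-1) 0 x ->
    Rabs (g i x) <= (- x) ^ (3 * i + 2) / INR (fact (3 * i + 2)) /\
    Rabs (Derive_n_on (Icc (-1) 0) (g i) 1 x) <= / INR (fact (3 * i + 1)) /\
    Rabs (Derive_n_on (Icc (-1) 0) (g i) 2 x) <= (1 + a) / INR (fact (3 * i)).
Proof.
intros Ha Hg. set (I := Icc (-1) 0).
induction i as [| i IH].
- destruct (generating_functions_source a g 0 Hg) as [Hc Hs].
  apply (cauchy_solution_bound a _ _ (g O) 0 Ha Hc Hs).
  intros x Hx.
  assert (Reg := cauchy_solution_regular a _ _ _ Hc Hs).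
  destruct Hs as (_ & _ & _ & u0 & du0 & ddu0).
  (* For [g 0] this quantity is conserved, and its value at [0] is [1]; this is the case [k = 0] of
     the required bound. *)
  set (h := fun t => Derive_n_on I (g O) 2 t + a * g O t).
  assert (D : forall t, Icc (-1) 0 t -> is_derive_on I h t 0).
  { intros t Ht. destruct (Reg t Ht) as (R0 & _ & R2).
    replace 0 with ((0 - a * Derive_n_on I (g O) 1 t)
      + a * Derive_n_on I (g O) 1 t) by ring.
    apply is_derive_on_plus; [exact R2 | now apply is_derive_on_scal]. }
  assert (h0 : h 0 = 1).
  { unfold h. fold I in ddu0. rewrite u0, ddu0. ring. }
  assert (L : Rabs (h 0 - h x) <= 0 * Rabs (0 - x)).
  { apply (Lipschitz_Icc (-1) 0 h (fun _ => 0)); [lra | exact D | | exact Hx |].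
    - intros t _. rewrite Rabs_R0; lra.
    - unfold Icc; lra. }
  change (Rabs (h x) <= (- x) ^ 0 / INR (fact 0)).
  replace (h x) with 1.
  + rewrite Rabs_R1. simpl; lra.
  + rewrite Rmult_0_l, h0 in L.
    apply Rminus_diag_uniq, Rabs_eq_0, Rle_antisym; [exact L | apply Rabs_pos].
- destruct (generating_functions_source a g (S i) Hg) as [Hc Hs].
  replace (3 * S i + 2)%nat with (S (S (S (3 * i + 2)))) by lia.
  replace (3 * S i + 1)%nat with (S (S (3 * i + 2))) by lia.
  replace (3 * S i)%nat with (S (3 * i + 2)) by lia.
  apply (cauchy_solution_bound a _ _ (g (S i)) _ Ha Hc Hs).
  assert (Reg := cauchy_solution_regular a _ _ _ Hc Hs).
  destruct Hs as (_ & _ & _ & u0 & du0 & ddu0).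
  assert (D : forall t, Icc (-1) 0 t ->
    is_derive_on I (fun x => Derive_n_on I (g (S i)) 2 x + a * g (S i) x) t (- g i t)).
  { intros t Ht. destruct (Reg t Ht) as (R0 & _ & R2).
    replace (- g i t) with ((- g i t - a * Derive_n_on I (g (S i)) 1 t)
      + a * Derive_n_on I (g (S i)) 1 t) by ring.
    apply is_derive_on_plus; [exact R2 | now apply is_derive_on_scal]. }
  intros x Hx.
  rewrite <- (Rmult_1_l (_ ^ _)).
  apply (power_fact_integral_bound
    (fun x => Derive_n_on I (g (S i)) 2 x + a * g (S i) x) (fun t => - g i t)).
  + exact (is_derive_on_continuous _ _ _ D).
  + intros t Ht. apply (is_derive_on_interior (-1) 0); [exact Ht |].
    apply D; unfold Icc; lra.
  + intros t Ht. rewrite Rabs_Ropp, Rmult_1_l. now apply IH.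
  + fold I in ddu0. rewrite u0, ddu0. ring.
  + exact Hx.
Qed.

(** Smoothness is bootstrapped from the differentiated equation. Recursion and differentiability go
    through one induction, since the recursion exhibits the derivative of order [n + 3] as a
    combination of lower ones already known to be differentiable; [i] stays universal because index
    [i - 1] occurs. *)
Lemma generating_functions_derivatives (a : R) (g : nat -> R -> R) :
  generating_functions a g ->
  let G n i := Derive_n_on (Icc (-1) 0) (g i) n in
  forall n,
    (forall i x, Icc (-1) 0 x ->
       G (S (S (S n))) i x =
       match i with O => 0 | S j => - G n j x end - a * G (S n) i x) /\
    (forall i x, Icc (-1) 0 x ->
       is_derive_on (Icc (-1) 0) (G n i) x (G (S n) i x) /\
       is_derive_on (Icc (-1) 0) (G (S n) i) x (G (S (S n)) i x) /\
       is_derive_on (Icc (-1) 0) (G (S (S n)) i) x (G (S (S (S n))) i x)).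
Proof.
intros Hg G. induction n as [| n [IHE IHD]].
- assert (Reg := fun i => cauchy_solution_regular a _ _ _
    (proj1 (generating_functions_source a g i Hg))
    (proj2 (generating_functions_source a g i Hg))).
  assert (E : forall i x, Icc (-1) 0 x ->
    G 3%nat i x = match i with O => 0 | S j => - G O j x end - a * G 1%nat i x).
  { intros i x Hx. apply Derive_on_eq; [lra | exact Hx | now apply Reg]. }
  split; [exact E |].
  intros i x Hx. rewrite E by exact Hx. now apply (Reg i).
- assert (D : forall i x, Icc (-1) 0 x ->
    is_derive_on (Icc (-1) 0) (G (S (S (S n))) i) x
      (match i with O => 0 | S j => - G (S n) j x end - a * G (S (S n)) i x)).
  { intros i x Hx.
    apply (is_derive_on_ext _
      (fun t => match i with O => 0 | S j => -1 * G n j t end + (- a) * G (S n) i t)).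
    - exact Hx.
    - intros t Ht. rewrite IHE by exact Ht. destruct i; ring.
    - replace (_ - _) with
        (match i with O => 0 | S j => -1 * G (S n) j x end + (- a) * G (S (S n)) i x)
        by (destruct i; ring).
      apply is_derive_on_plus.
      + destruct i as [| j]; [apply is_derive_on_const |].
        exact (is_derive_on_scal _ (-1) _ _ _ (proj1 (IHD j x Hx))).
      + exact (is_derive_on_scal _ (- a) _ _ _ (proj1 (proj2 (IHD i x Hx)))). }
  assert (E : forall i x, Icc (-1) 0 x ->
    G (S (S (S (S n)))) i x =
      match i with O => 0 | S j => - G (S n) j x end - a * G (S (S n)) i x).
  { intros i x Hx. apply Derive_on_eq; [lra | exact Hx | now apply D]. }
  split; [exact E |].
  intros i x Hx. destruct (IHD i x Hx) as (_ & D1 & D2).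
  split; [exact D1 | split; [exact D2 |]].
  rewrite E by exact Hx. now apply D.
Qed.

(* The subtraction [3 * i + 2 - n] is truncated: it makes the estimate hold
   for every order [n], in particular when [n > 3 * i + 2]. *)
Lemma generating_functions_bound (a : R) (g : nat -> R -> R) :
  0 <= a -> generating_functions a g ->
  forall (n i : nat) (x : R), Icc (-1) 0 x ->
    Rabs (Derive_n_on (Icc (-1) 0) (g i) n x)
      <= (1 + a) ^ (i + n + 1) / INR (fact (3 * i + 2 - n)).
Proof.
intros Ha Hg.
assert (Hdiv : forall p q x m k, 0 <= p <= q -> x <= p / INR (fact m) ->
  (k <= m)%nat -> x <= q / INR (fact k)).
{ intros p q x m k Hpq Hx Hkm. eapply Rle_trans; [exact Hx |].
  apply Rmult_le_compat; try lra.
  - left; apply Rinv_0_lt_compat, INR_fact_lt_0.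
  - apply Rinv_le_contravar; [apply INR_fact_lt_0 | now apply le_INR, fact_le]. }
assert (Hpow : forall p q, (p <= q)%nat -> 0 <= (1 + a) ^ p <= (1 + a) ^ q).
{ intros p q Hpq; split; [apply pow_le; lra | apply Rle_pow; [lra | exact Hpq]]. }
assert (Hpos : forall q, 1 <= (1 + a) ^ q) by (intros q; apply pow_R1_Rle; lra).
assert (Low := generating_functions_low_bounds a g Ha Hg).
(* Three consecutive orders are carried along, since order [n + 3] is computed from orders [n] and
   [n + 1]. *)
assert (Q : forall n, (forall i x, Icc (-1) 0 x ->
    Rabs (Derive_n_on (Icc (-1) 0) (g i) n x)
      <= (1 + a) ^ (i + n + 1) / INR (fact (3 * i + 2 - n))) /\
  (forall i x, Icc (-1) 0 x ->
    Rabs (Derive_n_on (Icc (-1) 0) (g i) (S n) x)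
      <= (1 + a) ^ (i + S n + 1) / INR (fact (3 * i + 2 - S n))) /\
  (forall i x, Icc (-1) 0 x ->
    Rabs (Derive_n_on (Icc (-1) 0) (g i) (S (S n)) x)
      <= (1 + a) ^ (i + S (S n) + 1) / INR (fact (3 * i + 2 - S (S n))))).
{ induction n as [| n (IH0 & IH1 & IH2)].
  - split; [| split]; intros i x Hx; destruct (Low i x Hx) as (L0 & L1 & L2).
    + apply Hdiv with (2 := L0); [| lia]. unfold Icc in Hx.
      split; [apply pow_le; lra |].
      apply Rle_trans with (2 := Hpos _).
      rewrite <- (pow1 (3 * i + 2)). apply pow_incr; lra.
    + apply (Hdiv 1 _ _ (3 * i + 1)%nat); [| | lia].
      * split; [lra | apply Hpos].
      * unfold Rdiv; rewrite Rmult_1_l; exact L1.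
    + apply Hdiv with (2 := L2); [| lia].
      rewrite <- (pow_1 (1 + a)) at 1 2. apply Hpow; lia.
  - split; [exact IH1 | split; [exact IH2 |]]. intros i x Hx.
    rewrite (proj1 (generating_functions_derivatives a g Hg n)) by exact Hx.
    set (k := (3 * i + 2 - S (S (S n)))%nat).
    set (F := / INR (fact k)).
    assert (HF : 0 < F) by (apply Rinv_0_lt_compat, INR_fact_lt_0).
    assert (B1 : Rabs (Derive_n_on (Icc (-1) 0) (g i) (S n) x)
                 <= (1 + a) ^ (i + n + 2) * F).
    { apply Hdiv with (2 := IH1 i x Hx); [apply Hpow; lia | unfold k; lia]. }
    (* Lowering the index by one costs three in the factorial argument, exactly as much as three
       derivatives: [3 * j + 2 - n = k] when [i = S j]. *)
    assert (B0 : Rabs (match i with O => 0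
        | S j => - Derive_n_on (Icc (-1) 0) (g j) n x end)
        <= (1 + a) ^ (i + n + 2) * F).
    { destruct i as [| j].
      - rewrite Rabs_R0. apply Rmult_le_pos; [apply pow_le; lra | lra].
      - rewrite Rabs_Ropp.
        apply Hdiv with (2 := IH0 j x Hx); [apply Hpow; lia | unfold k; lia]. }
    unfold Rminus. eapply Rle_trans; [apply Rabs_triang |].
    rewrite Rabs_Ropp, Rabs_mult, (Rabs_right a) by lra.
    apply Rle_trans with ((1 + a) ^ (i + n + 3) * F).
    + replace (i + n + 3)%nat with (S (i + n + 2)) by lia. simpl pow. nra.
    + apply Rmult_le_compat_r; [left; exact HF |]. apply Hpow; lia. }
intros n; apply Q.
Qed.

(** * Factorials and the Gevrey estimate *)

Lemma INR_fact_mult_le (n m : nat) :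
  INR (fact n) * INR (fact m) <= INR (fact (n + m)).
Proof.
rewrite <- mult_INR. apply le_INR.
induction n as [| n IH]; [simpl; lia |].
change (S n + m)%nat with (S (n + m)). rewrite !fact_simpl. nia.
Qed.

(** A binomial coefficient is at most [2 ^ (n + m)]. The induction is Pascal's rule cleared of
    denominators: [(n + m)!] is [n + m] times [(n + m - 1)!], and the last factorial is split in two
    ways. *)
Lemma INR_fact_add_le (n m : nat) :
  INR (fact (n + m)) <= 2 ^ (n + m) * (INR (fact n) * INR (fact m)).
Proof.
replace 2 with (INR 2) by reflexivity.
rewrite <- pow_INR, <- !mult_INR. apply le_INR.
remember (n + m)%nat as k eqn:E. revert n m E.
induction k as [| k IH]; intros n m E.
- replace n with O by lia. replace m with O by lia. simpl; lia.
- destruct n as [| n]; [| destruct m as [| m]].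
  + simpl in E; subst m. assert (1 <= 2 ^ S k)%nat by (apply Nat.lt_le_incl, Nat.pow_gt_1; lia).
    change (fact 0) with 1%nat. nia.
  + replace n with k by lia.
    assert (1 <= 2 ^ S k)%nat by (apply Nat.lt_le_incl, Nat.pow_gt_1; lia).
    change (fact 0) with 1%nat. nia.
  + assert (H1 := IH n (S m) ltac:(lia)). assert (H2 := IH (S n) m ltac:(lia)).
    rewrite (fact_simpl k), Nat.pow_succ_r'.
    replace (S k) with (S n + S m)%nat by lia.
    rewrite Nat.mul_add_distr_r.
    apply (Nat.mul_le_mono_l _ _ (S n)) in H1.
    apply (Nat.mul_le_mono_l _ _ (S m)) in H2.
    rewrite (fact_simpl n), (fact_simpl m) in *. nia.
Qed.

Lemma Rpower_pos (x y : R) : 0 < Rpower x y.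
Proof. apply exp_pos. Qed.

Lemma Rpower_pow_comm (x s : R) (n : nat) :
  0 < x -> Rpower (x ^ n) s = Rpower x s ^ n.
Proof.
intros Hx. rewrite <- !Rpower_pow by (exact Hx || apply Rpower_pos).
rewrite !Rpower_mult. f_equal; ring.
Qed.

(** With [c = b ^ (1 / d)], the sequence [c ^ j / j!] tends to zero, hence is bounded; the bound is
    then raised to the power [d]. *)
Lemma pow_le_Rpower_fact (b d : R) :
  0 < b -> 0 < d -> exists K : R, 0 < K /\
    forall j : nat, b ^ j <= K * Rpower (INR (fact j)) d.
Proof.
intros Hb Hd.
set (c := Rpower b (/ d)).
destruct (maj_by_pos (fun j => c ^ j / INR (fact j))) as [L [HL H]].
{ exists 0; apply cv_speed_pow_fact. }
exists (Rpower L d); split; [apply Rpower_pos | intros j].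
assert (Hc : 0 < c) by apply Rpower_pos.
assert (Hf := INR_fact_lt_0 j).
rewrite Rpower_mult_distr by assumption.
replace (b ^ j) with (Rpower (c ^ j) d).
- apply Rle_Rpower_l; [lra | split; [now apply pow_lt |]].
  specialize (H j). apply Rle_trans with (c ^ j / INR (fact j) * INR (fact j)).
  + right; field; lra.
  + apply Rmult_le_compat_r; [lra |]. eapply Rle_trans; [apply Rle_abs | exact H].
- rewrite Rpower_pow_comm by exact Hc. unfold c.
  rewrite Rpower_mult, Rinv_l, Rpower_1; lra.
Qed.

(* Put [j = 3 i + 2 - n] (truncated). As [3 i <= n + j],
   [(i!)^s <= ((3 i)!)^(s/3) <= 2^(n+j) (n!)^(s/3) (j!)^(s/3)], and what is
   left of [1/j!] is [(j!)^-(1 - s/3)], which beats every geometric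
   sequence in [j], hence in [3 i - n]. *)
Lemma fact_weight_bound (s q : R) :
  0 <= s < 3 -> 0 < q -> exists K A : R, 0 < K /\ 0 < A /\
    forall n i : nat,
      q ^ i * Rpower (INR (fact i)) s / INR (fact (3 * i + 2 - n))
        <= K * A ^ n * Rpower (INR (fact n)) (s / 3) * (/ 2) ^ i.
Proof.
intros Hs Hq.
(* The [2] pays for the factor [(/ 2) ^ i]; being at least [1] lets [b ^ i] be replaced by
   [b ^ (n + j)], as [i <= n + j]. *)
set (b := Rmax 1 (2 * q)).
assert (Hb1 : 1 <= b) by apply Rmax_l.
assert (Hb2 : 2 * q <= b) by apply Rmax_r.
destruct (pow_le_Rpower_fact (2 * b) (1 - s / 3)) as [K [HK H]]; try lra.
exists K, (2 * b); split; [exact HK | split; [lra |]].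
intros n i. set (j := (3 * i + 2 - n)%nat). specialize (H j).
assert (Fpos := INR_fact_lt_0).
set (Rn := Rpower (INR (fact n)) (s / 3)).
set (Rj := Rpower (INR (fact j)) (s / 3)).
set (Dj := Rpower (INR (fact j)) (1 - s / 3)) in *.
assert (HRn : 0 < Rn) by apply Rpower_pos.
assert (HRj : 0 < Rj) by apply Rpower_pos.
assert (HDj : 0 < Dj) by apply Rpower_pos.
assert (Ej : INR (fact j) = Rj * Dj).
{ unfold Rj, Dj. rewrite <- Rpower_plus.
  replace (s / 3 + (1 - s / 3)) with 1 by ring. now rewrite Rpower_1. }
assert (Hi : Rpower (INR (fact i)) s <= 2 ^ n * 2 ^ j * (Rn * Rj)).
{ replace s with (INR 3 * (s / 3)) at 1 by (simpl; field).
  rewrite <- Rpower_mult, Rpower_pow by apply Fpos.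
  apply Rle_trans with (Rpower (2 ^ (n + j) * (INR (fact n) * INR (fact j))) (s / 3)).
  - apply Rle_Rpower_l; [lra |].
    split; [now apply pow_lt |].
    apply Rle_trans with (INR (fact (n + j))); [| apply INR_fact_add_le].
    apply Rle_trans with (INR (fact (i + (i + i)))).
    + apply Rle_trans with (2 := INR_fact_mult_le _ _).
      simpl pow. rewrite Rmult_1_r. apply Rmult_le_compat_l; [left; apply Fpos |].
      apply INR_fact_mult_le.
    + apply le_INR, fact_le; lia.
  - assert (H2 : 0 < 2 ^ (n + j)) by (apply pow_lt; lra).
    rewrite <- !Rpower_mult_distr; auto using Rmult_lt_0_compat.
    fold Rn Rj. apply Rmult_le_compat_r; [nra |].
    (* Since [s / 3 <= 1], the power of two may be raised from exponent [s / 3] to exponent [1]. *)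
    rewrite <- pow_add. rewrite <- (Rpower_1 (2 ^ (n + j))) at 2 by exact H2.
    apply Rle_Rpower; [apply pow_R1_Rle; lra | lra]. }
assert (Hqi : q ^ i <= b ^ n * b ^ j * (/ 2) ^ i).
{ apply Rle_trans with (b ^ i * (/ 2) ^ i).
  - rewrite <- Rpow_mult_distr. apply pow_incr; lra.
  - apply Rmult_le_compat_r; [apply pow_le; lra |].
    rewrite <- pow_add. apply Rle_pow; [exact Hb1 | lia]. }
assert (P2 : forall k, 0 < 2 ^ k) by (intros k; apply pow_lt; lra).
assert (Pb : forall k, 0 < b ^ k) by (intros k; apply pow_lt; lra).
assert (Ph : 0 < (/ 2) ^ i) by (apply pow_lt; lra).
apply Rle_trans with
  ((b ^ n * b ^ j * (/ 2) ^ i) * (2 ^ n * 2 ^ j * (Rn * Rj)) / INR (fact j)).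
- apply Rmult_le_compat_r; [left; apply Rinv_0_lt_compat, Fpos |].
  apply Rmult_le_compat; [apply pow_le; lra | left; apply Rpower_pos | exact Hqi | exact Hi].
- rewrite Ej, Rpow_mult_distr.
  replace (b ^ n * b ^ j * (/ 2) ^ i * (2 ^ n * 2 ^ j * (Rn * Rj)) / (Rj * Dj)) with
    ((2 ^ n * b ^ n * Rn * (/ 2) ^ i) * (2 ^ j * b ^ j / Dj)) by (field; lra).
  rewrite Rpow_mult_distr in H.
  replace (K * (2 ^ n * b ^ n) * Rn * (/ 2) ^ i)
    with ((2 ^ n * b ^ n * Rn * (/ 2) ^ i) * K) by ring.
  apply Rmult_le_compat_l.
  + left; repeat apply Rmult_lt_0_compat; auto.
  + apply Rmult_le_reg_r with Dj; [exact HDj |].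
    replace (2 ^ j * b ^ j / Dj * Dj) with (2 ^ j * b ^ j) by (field; lra).
    exact H.
Qed.

(** The factorial of [i + m] is split by the binomial bound; what depends on [i] is then a geometric
    factor times [(i!)^s] over [(3 i + 2 - n)!], the weight estimated before. *)
Lemma generating_series_bound (a T s : R) (z : R -> R) (g : nat -> R -> R) :
  0 <= a -> 0 <= s < 3 -> gevrey s 0 T z -> generating_functions a g ->
  exists C A1 A2 : R, 0 < C /\ 0 < A1 /\ 0 < A2 /\
    forall (n m i : nat) (x t : R), Icc (-1) 0 x -> Icc 0 T t ->
      Rabs (Derive_n_on (Icc (-1) 0) (g i) n x
            * Derive_n_on (Icc 0 T) z (i + m) t)
        <= C * (A1 ^ n * A2 ^ m)
             * (Rpower (INR (fact n)) (s / 3) * Rpower (INR (fact m)) s)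
             * (/ 2) ^ i.
Proof.
intros Ha Hs (_ & C & r & HC & Hr & Hz) Hg.
set (M := 1 + a). assert (HM : 0 < M) by (unfold M; lra).
(* [8 = 2 ^ 3] dominates the [2 ^ s] produced by splitting [(i + m)!], and [r] is the Gevrey radius
   of [z]. *)
set (p := 8 / r). assert (Hp : 0 < p) by (apply Rdiv_lt_0_compat; lra).
assert (Fpos := INR_fact_lt_0).
destruct (fact_weight_bound s (M * p)) as (K & A & HK & HA & H).
{ exact Hs. } { now apply Rmult_lt_0_compat. }
(* [C + 1] is positive even if [C = 0]; the single [M] is the extra unit in the exponent
   [i + n + 1]. *)
exists ((C + 1) * M * K), (M * A), p.
split; [repeat apply Rmult_lt_0_compat; lra |].
split; [now apply Rmult_lt_0_compat | split; [exact Hp |]].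
intros n m i x t Hx Ht. specialize (H n i).
rewrite Rabs_mult.
assert (BG := generating_functions_bound a g Ha Hg n i x Hx). fold M in BG.
specialize (Hz (i + m)%nat t Ht).
set (Fj := INR (fact (3 * i + 2 - n))) in *.
assert (HFj : 0 < Fj) by apply Fpos.
set (Ri := Rpower (INR (fact i)) s) in *.
set (Rm := Rpower (INR (fact m)) s) in *.
set (Rn := Rpower (INR (fact n)) (s / 3)) in *.
assert (HRi : 0 < Ri) by apply Rpower_pos.
assert (HRm : 0 < Rm) by apply Rpower_pos.
assert (Him : Rpower (INR (fact (i + m))) s <= 8 ^ (i + m) * (Ri * Rm)).
{ assert (P2 : 0 < 2 ^ (i + m)) by (apply pow_lt; lra).
  apply Rle_trans with (Rpower (2 ^ (i + m) * (INR (fact i) * INR (fact m))) s).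
  - apply Rle_Rpower_l; [lra | split; [apply Fpos | apply INR_fact_add_le]].
  - rewrite <- !Rpower_mult_distr; auto using Rmult_lt_0_compat.
    fold Ri Rm. apply Rmult_le_compat_r; [nra |].
    replace 8 with (2 ^ 3) by ring. rewrite <- pow_mult, Nat.mul_comm, pow_mult.
    rewrite <- (Rpower_pow 3) by exact P2.
    apply Rle_Rpower; [apply pow_R1_Rle; lra | simpl; lra]. }
assert (Pr : 0 < r ^ (i + m)) by now apply pow_lt.
assert (BZ : Rabs (Derive_n_on (Icc 0 T) z (i + m) t)
             <= (C + 1) * (p ^ (i + m) * (Ri * Rm))).
{ eapply Rle_trans; [exact Hz |].
  replace ((C + 1) * (p ^ (i + m) * (Ri * Rm)))
    with ((C + 1) * (8 ^ (i + m) * (Ri * Rm)) / r ^ (i + m)).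
  - apply Rmult_le_compat_r; [left; now apply Rinv_0_lt_compat |].
    apply Rmult_le_compat; [exact HC | left; apply Rpower_pos | lra | exact Him].
  - unfold p, Rdiv. rewrite Rpow_mult_distr, pow_inv. ring. }
eapply Rle_trans.
{ apply Rmult_le_compat; [apply Rabs_pos | apply Rabs_pos | exact BG | exact BZ]. }
replace (M ^ (i + n + 1) / Fj * ((C + 1) * (p ^ (i + m) * (Ri * Rm))))
  with (((C + 1) * M * M ^ n * p ^ m * Rm) * ((M * p) ^ i * Ri / Fj)).
- replace ((C + 1) * M * K * ((M * A) ^ n * p ^ m) * (Rn * Rm) * (/ 2) ^ i)
    with (((C + 1) * M * M ^ n * p ^ m * Rm) * (K * A ^ n * Rn * (/ 2) ^ i)).
  + apply Rmult_le_compat_l; [| exact H].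
    left; repeat apply Rmult_lt_0_compat; auto using pow_lt; lra.
  + rewrite (Rpow_mult_distr M A); ring.
- rewrite !pow_add, Rpow_mult_distr. field; lra.
Qed.

(** * Smoothness of the series *)

Lemma Derive_n_on_tower (a b : R) (f : R -> R) (F : nat -> R -> R) :
  a < b ->
  (forall x, Icc a b x -> f x = F O x) ->
  (forall n x, Icc a b x -> is_derive_on (Icc a b) (F n) x (F (S n) x)) ->
  forall n x, Icc a b x -> Derive_n_on (Icc a b) f n x = F n x.
Proof.
intros Hab H0 HS. induction n as [| n IH]; intros x Hx; [now apply H0 |].
apply Derive_on_eq; [exact Hab | exact Hx |].
apply (is_derive_on_ext _ (F n)); [exact Hx | | now apply HS].
intros y Hy; symmetry; now apply IH.
Qed.

(** [W n m] stands for the mixed partial of orders [n] in [x] and [m] in [t]; the double indexing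
    builds in that the two differentiations commute. *)
Definition derivative_tower (Dx Dt : R -> Prop)
    (W : nat -> nat -> R -> R -> R) : Prop :=
  forall n m x t, Dx x -> Dt t ->
    is_derive_on Dx (fun x' => W n m x' t) x (W (S n) m x t) /\
    is_derive_on Dt (fun t' => W n m x t') t (W n (S m) x t).

Lemma partial_on_tower (x1 x2 t1 t2 : R) (W : nat -> nat -> R -> R -> R)
    (y : R -> R -> R) :
  x1 < x2 -> t1 < t2 ->
  derivative_tower (Icc x1 x2) (Icc t1 t2) W ->
  (forall x t, Icc x1 x2 x -> Icc t1 t2 t -> y x t = W O O x t) ->
  forall n1 n2 x t, Icc x1 x2 x -> Icc t1 t2 t ->
    partial_on (Icc x1 x2) (Icc t1 t2) n1 n2 y x t = W n1 n2 x t.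
Proof.
intros Hx12 Ht12 HW Hy n1 n2 x t Hx Ht. unfold partial_on.
apply (Derive_n_on_tower x1 x2 _ (fun n x' => W n n2 x' t)); auto.
- intros x' Hx'.
  apply (Derive_n_on_tower t1 t2 _ (fun m t' => W O m x' t')); auto.
  intros m t' Ht'; exact (proj2 (HW O m x' t' Hx' Ht')).
- intros n x' Hx'; exact (proj1 (HW n n2 x' t Hx' Ht)).
Qed.

(** Bounds on the two neighbouring entries make [W n m] Lipschitz in each variable, hence jointly
    continuous. Starting from arbitrary [n] and [m] lets the induction on the order of smoothness
    move to these neighbours. *)
Lemma Cinf_rect_tower (x1 x2 t1 t2 : R) (W : nat -> nat -> R -> R -> R)
    (K : nat -> nat -> R) :
  x1 < x2 -> t1 < t2 ->
  derivative_tower (Icc x1 x2) (Icc t1 t2) W ->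
  (forall n m x t, Icc x1 x2 x -> Icc t1 t2 t -> Rabs (W n m x t) <= K n m) ->
  forall (n m : nat) (y : R -> R -> R),
    (forall x t, Icc x1 x2 x -> Icc t1 t2 t -> y x t = W n m x t) ->
    Cinf_rect (Icc x1 x2) (Icc t1 t2) y.
Proof.
intros Hx12 Ht12 HW HK n m y Hy k. revert n m y Hy.
assert (Cont : forall n m y,
    (forall x t, Icc x1 x2 x -> Icc t1 t2 t -> y x t = W n m x t) ->
    continuous_on_rect (Icc x1 x2) (Icc t1 t2) y).
{ intros n m y Hy [x t] [Hx Ht]; simpl in Hx, Ht.
  apply filterlim_locally; intros eps.
  set (L := K (S n) m + K n (S m) + 1).
  assert (L1 : 0 <= K (S n) m) by exact (Rle_trans _ _ _ (Rabs_pos _) (HK _ _ x t Hx Ht)).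
  assert (L2 : 0 <= K n (S m)) by exact (Rle_trans _ _ _ (Rabs_pos _) (HK _ _ x t Hx Ht)).
  assert (HL : 0 < eps / L) by (apply Rdiv_lt_0_compat; [apply cond_pos | unfold L; lra]).
  exists (mkposreal _ HL). intros [x' t'] [Bx Bt] [Hx' Ht']; simpl in Hx', Ht'.
  change (Rabs (x' - x) < eps / L) in Bx. change (Rabs (t' - t) < eps / L) in Bt.
  change (Rabs (y x' t' - y x t) < eps).
  rewrite !Hy by assumption.
  (* The increment is split at the corner [(x, t')]. *)
  assert (Lx : Rabs (W n m x' t' - W n m x t') <= K (S n) m * Rabs (x' - x)).
  { apply (Lipschitz_Icc x1 x2 (fun u => W n m u t') (fun u => W (S n) m u t')); auto.
    intros u Hu; exact (proj1 (HW n m u t' Hu Ht')). }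
  assert (Lt : Rabs (W n m x t' - W n m x t) <= K n (S m) * Rabs (t' - t)).
  { apply (Lipschitz_Icc t1 t2 (fun u => W n m x u) (fun u => W n (S m) x u)); auto.
    intros u Hu; exact (proj2 (HW n m x u Hx Hu)). }
  replace (W n m x' t' - W n m x t)
    with ((W n m x' t' - W n m x t') + (W n m x t' - W n m x t)) by ring.
  eapply Rle_lt_trans; [apply Rabs_triang |].
  replace (pos eps) with (eps / L * L) by (field; unfold L; lra).
  unfold L at 2. nra. }
induction k as [| k IH]; intros n m y Hy.
- split; [now apply (Cont n m) | exact I].
- assert (Hd : forall x t, Icc x1 x2 x -> Icc t1 t2 t ->
    is_derive_on (Icc x1 x2) (fun x' => y x' t) x (W (S n) m x t) /\
    is_derive_on (Icc t1 t2) (fun t' => y x t') t (W n (S m) x t)).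
  { intros x t Hx Ht; destruct (HW n m x t Hx Ht) as [Wx Wt]; split.
    - apply (is_derive_on_ext _ (fun x' => W n m x' t)); [exact Hx | | exact Wx].
      intros x' Hx'; symmetry; now apply Hy.
    - apply (is_derive_on_ext _ (fun t' => W n m x t')); [exact Ht | | exact Wt].
      intros t' Ht'; symmetry; now apply Hy. }
  split; [now apply (Cont n m) | split; [| split]].
  + intros x t Hx Ht; destruct (Hd x t Hx Ht); split; eexists; eassumption.
  + apply (IH (S n) m). intros x t Hx Ht.
    exact (Derive_on_eq _ _ _ _ _ Hx12 Hx (proj1 (Hd x t Hx Ht))).
  + apply (IH n (S m)). intros x t Hx Ht.
    exact (Derive_on_eq _ _ _ _ _ Ht12 Ht (proj2 (Hd x t Hx Ht))).
Qed.

(** With one variable frozen, termwise differentiation applies; the bounds it requires on the next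
    two derivatives are those of [K] at the next two orders. *)
Lemma series_derivative_tower (x1 x2 t1 t2 : R) (G Z : nat -> nat -> R -> R)
    (K : nat -> nat -> R) :
  x1 < x2 -> t1 < t2 ->
  (forall n i x, Icc x1 x2 x -> is_derive_on (Icc x1 x2) (G n i) x (G (S n) i x)) ->
  (forall m i t, Icc t1 t2 t -> is_derive_on (Icc t1 t2) (Z m i) t (Z (S m) i t)) ->
  (forall n m i x t, Icc x1 x2 x -> Icc t1 t2 t ->
     Rabs (G n i x * Z m i t) <= K n m * (/ 2) ^ i) ->
  derivative_tower (Icc x1 x2) (Icc t1 t2)
    (fun n m x t => Series (fun i => G n i x * Z m i t)).
Proof.
intros Hx12 Ht12 HG HZ HK n m x t Hx Ht; split.
- assert (D : forall n i u, Icc x1 x2 u ->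
    is_derive_on (Icc x1 x2) (fun v => G n i v * Z m i t) u (G (S n) i u * Z m i t)).
  { intros n' i u Hu.
    apply (is_derive_on_ext _ (fun v => Z m i t * G n' i v)).
    - exact Hu.
    - intros v _; apply Rmult_comm.
    - rewrite Rmult_comm. exact (is_derive_on_scal _ _ _ _ _ (HG n' i u Hu)). }
  apply (is_derive_on_Series x1 x2 (fun i u => G n i u * Z m i t)
    (fun i u => G (S n) i u * Z m i t) (fun i u => G (S (S n)) i u * Z m i t)
    (K n m) (K (S n) m) (K (S (S n)) m)); auto.
- assert (D : forall m i u, Icc t1 t2 u ->
    is_derive_on (Icc t1 t2) (fun v => G n i x * Z m i v) u (G n i x * Z (S m) i u)).
  { intros m' i u Hu. exact (is_derive_on_scal _ _ _ _ _ (HZ m' i u Hu)). }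
  apply (is_derive_on_Series t1 t2 (fun i u => G n i x * Z m i u)
    (fun i u => G n i x * Z (S m) i u) (fun i u => G n i x * Z (S (S m)) i u)
    (K n m) (K n (S m)) (K n (S (S m)))); auto.
Qed.

Lemma Series_zero_tail (f : nat -> R) :
  (forall i, f (S i) = 0) -> Series f = f O.
Proof.
intros H.
assert (H0 : Series (fun i => f (S i)) = 0).
{ rewrite (Series_ext _ (fun _ => 0 * 0)), Series_scal_l; [ring |].
  intros i. rewrite H; ring. }
rewrite Series_incr_1, H0, Rplus_0_r; [reflexivity |].
apply ex_series_incr_1, (ex_series_ext (fun i => 0 * (/ 2) ^ i)).
- intros i. change (0 * (/ 2) ^ i = f (S i)). rewrite H; ring.
- apply (ex_series_scal_l (V := R_NormedModule)), ex_series_geom.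
  rewrite Rabs_right; lra.
Qed.

(** * Gevrey regularity, the equation and the boundary data *)

Theorem proposition2p1 (a T s : R) (z : R -> R) (g : nat -> R -> R)
    (y : R -> R -> R)
    (ha : 0 <= a) (hT : 0 < T) (hs : 1 <= s < 3)
    (hz : gevrey s 0 T z)
    (hg : generating_functions a g)
    (hy : forall x t : R, -1 <= x <= 0 -> 0 <= t <= T ->
       y x t = Series (fun i : nat => g i x * Derive_n_on (Icc 0 T) z i t)) :
  (forall x t : R, -1 <= x <= 0 -> 0 <= t <= T ->
     ex_series (fun i : nat => g i x * Derive_n_on (Icc 0 T) z i t)) /\
  gevrey2 (s / 3) s (-1) 0 0 T y /\
  (forall x t : R, -1 < x < 0 -> 0 < t < T ->
     partial_on (Icc (-1) 0) (Icc 0 T) 0 1 y x t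
     + partial_on (Icc (-1) 0) (Icc 0 T) 3 0 y x t
     + a * partial_on (Icc (-1) 0) (Icc 0 T) 1 0 y x t = 0) /\
  (forall t : R, 0 < t < T ->
     y 0 t = 0 /\
     partial_on (Icc (-1) 0) (Icc 0 T) 1 0 y 0 t = 0 /\
     partial_on (Icc (-1) 0) (Icc 0 T) 2 0 y 0 t = z t).
Proof.
destruct (generating_series_bound a T s z g ha ltac:(lra) hz hg)
  as (C & A1 & A2 & HC & HA1 & HA2 & HB).
set (K := fun n m : nat => C * (A1 ^ n * A2 ^ m)
  * (Rpower (INR (fact n)) (s / 3) * Rpower (INR (fact m)) s)).
set (G := fun n i => Derive_n_on (Icc (-1) 0) (g i) n).
(* The [m]-th time derivative of the [i]-th coefficient [z^(i)]. *)
set (Z := fun m i => Derive_n_on (Icc 0 T) z (i + m)).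
set (W := fun n m x t => Series (fun i => G n i x * Z m i t)).
assert (HK : forall n m i x t, Icc (-1) 0 x -> Icc 0 T t ->
  Rabs (G n i x * Z m i t) <= K n m * (/ 2) ^ i).
{ intros n m i x t Hx Ht. exact (HB n m i x t Hx Ht). }
assert (HW : derivative_tower (Icc (-1) 0) (Icc 0 T) W).
{ apply (series_derivative_tower (-1) 0 0 T G Z K); [lra | exact hT | | | exact HK].
  - intros n i x Hx.
    exact (proj1 (proj2 (generating_functions_derivatives a g hg n) i x Hx)).
  - intros m i t Ht. unfold Z. rewrite <- plus_n_Sm.
    exact (Derive_on_correct 0 T _ t hT Ht (proj1 hz (i + m)%nat t Ht)). }
assert (Hex : forall n m x t, Icc (-1) 0 x -> Icc 0 T t ->
  ex_series (fun i => G n i x * Z m i t)).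
{ intros n m x t Hx Ht. apply (ex_series_dominated _ (K n m)). intros i; now apply HK. }
assert (HWK : forall n m x t, Icc (-1) 0 x -> Icc 0 T t ->
  Rabs (W n m x t) <= 2 * K n m).
{ intros n m x t Hx Ht. apply ex_series_dominated. intros i; now apply HK. }
assert (Z0 : forall i t, Z O i t = Derive_n_on (Icc 0 T) z i t).
{ intros i t; unfold Z; now rewrite <- plus_n_O. }
assert (Hy : forall x t, Icc (-1) 0 x -> Icc 0 T t -> y x t = W O O x t).
{ intros x t Hx Ht. rewrite hy by assumption.
  apply Series_ext; intros i; now rewrite Z0. }
assert (Hpart := partial_on_tower (-1) 0 0 T W y ltac:(lra) hT HW Hy).
split; [| split; [split |  split]].
- intros x t Hx Ht.
  apply (ex_series_ext (fun i => G O i x * Z O i t)); [| now apply Hex].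
  intros i; now rewrite Z0.
- exact (Cinf_rect_tower (-1) 0 0 T W (fun n m => 2 * K n m) ltac:(lra) hT HW HWK
    O O y Hy).
(* The [2] is the sum of the geometric series; the radii are the inverses of the growth rates. *)
- exists (2 * C), (/ A1), (/ A2).
  split; [lra | split; [now apply Rinv_0_lt_compat | split; [now apply Rinv_0_lt_compat |]]].
  intros n m x t Hx Ht. rewrite Hpart by assumption.
  eapply Rle_trans; [now apply HWK |]. right. unfold K.
  rewrite !pow_inv. field.
  split; apply pow_nonzero; lra.
- intros x t Hx Ht.
  assert (Ix : Icc (-1) 0 x) by (unfold Icc; lra).
  assert (It : Icc 0 T t) by (unfold Icc; lra).
  rewrite !Hpart by assumption. unfold W.
  rewrite <- Series_scal_l.
  rewrite Rplus_assoc, <- Series_plus; [| now apply Hex |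
    now apply (ex_series_scal_l (V := R_NormedModule)), Hex].
  (* By the recursion, the space terms at index [i] are [- g_(i-1) z^(i)]. After a shift of index
     they sum to the opposite of the series of the time derivative. *)
  set (h := fun i => match i with O => 0 | S j => - (G O j x * Z 1%nat j t) end).
  assert (E : forall i, G 3%nat i x * Z O i t + a * (G 1%nat i x * Z O i t) = h i).
  { intros i. unfold h.
    assert (E := proj1 (generating_functions_derivatives a g hg 0) i x Ix).
    change (G 3%nat i x =
      match i with O => 0 | S j => - G O j x end - a * G 1%nat i x) in E.
    rewrite E. destruct i as [| j]; [ring |].
    replace (Z O (S j) t) with (Z 1%nat j t); [ring |].
    unfold Z. now rewrite <- plus_n_Sm, <- !plus_n_O. }
  rewrite (Series_ext _ _ E), (Series_incr_1 h).
  + unfold h. rewrite Series_opp, Rplus_0_l. apply Rplus_opp_r.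
  + apply (ex_series_ext _ _ E).
    apply (ex_series_plus (V := R_NormedModule)); [now apply Hex |].
    now apply (ex_series_scal_l (V := R_NormedModule)), Hex.
- intros t Ht.
  assert (I0 : Icc (-1) 0 0) by (unfold Icc; lra).
  assert (It : Icc 0 T t) by (unfold Icc; lra).
  rewrite !Hpart, Hy by assumption.
  destruct hg as [(_ & _ & _ & g0 & g1 & g2) hS].
  (* At [x = 0] the Cauchy data of every [g (S i)] vanish, so only the term of [g 0], with data [0],
     [0], [1], survives. *)
  unfold W; split; [| split]; rewrite Series_zero_tail.
  + unfold G; simpl. rewrite g0; ring.
  + intros i. destruct (hS i) as (_ & _ & _ & h0 & _ & _).
    unfold G; simpl. rewrite h0; ring.
  + unfold G. rewrite g1; ring.
  + intros i. destruct (hS i) as (_ & _ & _ & _ & h1 & _).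
    unfold G. rewrite h1; ring.
  + unfold G. rewrite g2, Z0; simpl. ring.
  + intros i. destruct (hS i) as (_ & _ & _ & _ & _ & h2).
    unfold G. rewrite h2; ring.
Qed.
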